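(* Let $f\in\mathbb{R}^n$, $g\in\mathbb{R}^m$, and let $u_0\in\mathbb{R}^n$ be an arbitrary solution of the singular system $$Au_0=(I-B^TL^{-1}C^T)f .$$ Then the solution $(u,p)\in\mathbb{R}^n\times\mathbb{R}^m$ of the saddle-point system $$\begin{pmatrix} A & B^T\\ B & 0\end{pmatrix}\begin{pmatrix}u\\ p\end{pmatrix}=\begin{pmatrix}f\\ g\end{pmatrix}$$ is given by $$u=(I-CL^{-1}B)u_0+CL^{-1}g,\qquad p=L^{-1}C^Tf .$$ Equivalently, $$\begin{pmatrix}u\\ p\end{pmatrix}=\begin{pmatrix}(I-CL^{-1}B)A^{+}(I-B^TL^{-1}C^T) & CL^{-1}\\ L^{-1}C^T & 0\end{pmatrix}\begin{pmatrix}f\\ g\end{pmatrix},$$ where $A^{+}$ is any operator mapping each vector $b$ in the range of $A$ to a particular solution of $Ax=b$.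
   Context: Let $m\le n$. $A\in\mathbb{R}^{n\times n}$ is symmetric positive semidefinite with $\dim\ker(A)=m$; $M\in\mathbb{R}^{n\times n}$ is symmetric positive definite; $B\in\mathbb{R}^{m\times n}$ has full row rank; $C\in\mathbb{R}^{n\times m}$ is a matrix whose columns form a basis of $\ker(A)$ (so $AC=0$) and satisfies $MC=B^T$; and $L=BC\in\mathbb{R}^{m\times m}$ (so $L=C^TMC$ is symmetric positive definite). Then $\mathbb{R}^n=\ker(A)\oplus\ker(B)$ and the matrix $\begin{pmatrix} A & B^T\\ B & 0\end{pmatrix}$ is nonsingular. *)

(* Defs.v *)
From mathcomp Require Import all_boot all_order all_algebra.
From mathcomp Require Import reals.

Set Implicit Arguments.
Unset Strict Implicit.
Unset Printing Implicit Defensive.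

Import Order.TTheory GRing.Theory Num.Theory.
Local Open Scope ring_scope.

Definition sym_psd (R : realType) (n : nat) (A : 'M[R]_n) : Prop :=
  A^T = A /\ forall x : 'cV[R]_n, 0 <= (x^T *m A *m x) 0 0.

Definition sym_pd (R : realType) (n : nat) (M : 'M[R]_n) : Prop :=
  M^T = M /\ forall x : 'cV[R]_n, x != 0 -> 0 < (x^T *m M *m x) 0 0.

(* The kernel {x | A *m x = 0} acting on column vectors; [kermx] would be the
   kernel of the action on row vectors. *)
Definition colker (R : realType) (k n : nat) (A : 'M[R]_(k, n)) :
    {vspace 'cV[R]_n} :=
  lker (linfun (mulmx A : 'cV[R]_n -> 'cV[R]_k)).

Definition cols (R : realType) (n m : nat) (C : 'M[R]_(n, m)) :
    m.-tuple 'cV[R]_n :=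
  [tuple col j C | j < m].

(* [S] is only constrained on the range of [A], and need not be linear. *)
Definition solution_operator (R : realType) (n : nat) (A : 'M[R]_n)
    (S : 'cV[R]_n -> 'cV[R]_n) : Prop :=
  forall b : 'cV[R]_n, (exists x : 'cV[R]_n, A *m x = b) -> A *m S b = b.

(* A 2 x 2 block matrix of (possibly nonlinear) operators applied to the block
   vector (f, g); for linear entries this is [block_mx _ _ _ _ *m col_mx f g]. *)
Definition block_op (R : realType) (n m : nat)
    (P11 : 'cV[R]_n -> 'cV[R]_n) (P12 : 'cV[R]_m -> 'cV[R]_n)
    (P21 : 'cV[R]_n -> 'cV[R]_m) (P22 : 'cV[R]_m -> 'cV[R]_m)
    (f : 'cV[R]_n) (g : 'cV[R]_m) : 'cV[R]_(n + m) :=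
  col_mx (P11 f + P12 g) (P21 f + P22 g).

(* Main.v *)
(** Since [C^T A = 0] and [C^T B^T = L], multiplying the first block row by [C^T]
determines [p]; then [u] and [u0] differ by an element of [ker A], that is of the
column space of [C], and the coordinates of the difference are fixed by [B u = g].
The matrix [L = C^T M C] is invertible because [M] is positive definite, and the
equation for [u0] is solvable because its right-hand side is killed by [C^T],
hence orthogonal to the kernel of the symmetric matrix [A]. *)

Require Import Defs.
From mathcomp Require Import all_boot all_order all_algebra.
From mathcomp Require Import reals.

Set Implicit Arguments.
Unset Strict Implicit.
Unset Printing Implicit Defensive.

Import Order.TTheory GRing.Theory Num.Theory.
Local Open Scope ring_scope.

(** [kermx] consists of row vectors, so the argument runs through [L^T], whose left kernel is the
    transpose of the right kernel of [L]. *)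
Lemma unitmx_ker0 (F : fieldType) (m : nat) (L : 'M[F]_m) :
  (forall x : 'cV[F]_m, L *m x = 0 -> x = 0) -> L \in unitmx.
Proof.
move=> L_inj; rewrite -unitmx_tr -row_free_unit -kermx_eq0.
apply/eqP/row_matrixP => i; rewrite row0; apply: trmx_inj; rewrite trmx0.
by apply: L_inj; apply: trmx_inj; rewrite trmx_mul trmxK -row_mul mulmx_ker row0 trmx0.
Qed.

(** If the product kills [x], then the quadratic form of [M] vanishes at [C *m x], so definiteness
    forces [C *m x = 0]. *)
Lemma sym_pd_conj_unitmx (R : realType) (m n : nat) (M : 'M[R]_n)
    (C : 'M[R]_(n, m)) :
  sym_pd M -> (forall x : 'cV[R]_m, C *m x = 0 -> x = 0) ->
  C^T *m M *m C \in unitmx.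
Proof.
move=> [_ M_pos] C_inj; apply: unitmx_ker0 => x Lx0; apply: C_inj.
apply/eqP/negPn/negP => /M_pos.
by rewrite trmx_mul -!mulmxA (mulmxA M) (mulmxA C^T) (mulmxA C^T) Lx0 mulmx0 mxE ltxx.
Qed.

Lemma mem_colker (R : realType) (k n : nat) (A : 'M[R]_(k, n)) (x : 'cV[R]_n) :
  (x \in colker A) = (A *m x == 0).
Proof. by rewrite memv_ker lfunE. Qed.

Lemma colker_basis_mul0 (R : realType) (k m n : nat) (A : 'M[R]_(k, n))
    (C : 'M[R]_(n, m)) :
  basis_of (colker A) (cols C) -> A *m C = 0.
Proof.
move=> C_basis; apply/trmx_inj/row_matrixP => j.
rewrite -tr_col trmx0 row0 -[0]trmx0 colE -mulmxA -colE; congr (_^T).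
apply/eqP; rewrite -mem_colker; apply: (basis_mem C_basis).
by apply/mapP; exists j; rewrite ?mem_enum.
Qed.

(** Column [j] of [Y] holds the coordinates of column [j] of [X] in the basis. Allowing several
    columns lets this serve both a single kernel vector and the whole matrix [cokermx A]. *)
Lemma colker_basis_factor (R : realType) (k m n p : nat) (A : 'M[R]_(k, n))
    (C : 'M[R]_(n, m)) (X : 'M[R]_(n, p)) :
  basis_of (colker A) (cols C) -> A *m X = 0 -> exists Y, X = C *m Y.
Proof.
move=> C_basis AX0.
exists (\matrix_(i < m, j < p) coord (cols C) i (col j X)).
apply/matrixP => i j.
have Xj : col j X \in colker A by rewrite mem_colker colE mulmxA AX0 mul0mx.
have /matrixP/(_ i 0) := coord_basis C_basis Xj.
rewrite mxE summxE mxE => ->; apply: eq_bigr => l _.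
by rewrite !mxE -tnth_nth tnth_mktuple mxE mulrC.
Qed.

(** Fredholm alternative: [cokermx A] factors through [C], so [b^T] annihilates it and lies in the
    row space of [A], which by symmetry is the transposed column space. *)
Lemma sym_range_colker (R : realType) (m n : nat) (A : 'M[R]_n)
    (C : 'M[R]_(n, m)) (b : 'cV[R]_n) :
  A^T = A -> basis_of (colker A) (cols C) -> C^T *m b = 0 ->
  exists x : 'cV[R]_n, A *m x = b.
Proof.
move=> A_sym C_basis Cb0.
have [Y cokE] := colker_basis_factor C_basis (mulmx_coker A).
have /submxP[D bE] : (b^T <= A)%MS.
  by rewrite submxE cokE mulmxA -[C]trmxK -trmx_mul Cb0 trmx0 mul0mx.
by exists D^T; rewrite -[b]trmxK bE trmx_mul A_sym.
Qed.

Theorem mainTheorem3 (R : realType) (m n : nat) (A M : 'M[R]_n)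
    (B : 'M[R]_(m, n)) (C : 'M[R]_(n, m)) (L : 'M[R]_m)
    (le_mn : (m <= n)%N)
    (A_psd : sym_psd A) (A_ker : \dim (colker A) = m)
    (M_pd : sym_pd M)
    (B_full : row_free B)
    (C_basis : basis_of (colker A) (cols C)) (MC : M *m C = B^T)
    (L_def : L = B *m C)
    (f : 'cV[R]_n) (g : 'cV[R]_m) :
  (forall u0 : 'cV[R]_n,
     A *m u0 = (1%:M - B^T *m invmx L *m C^T) *m f ->
     forall (u : 'cV[R]_n) (p : 'cV[R]_m),
       block_mx A B^T B 0 *m col_mx u p = col_mx f g <->
       u = (1%:M - C *m invmx L *m B) *m u0 + C *m invmx L *m g /\
       p = invmx L *m C^T *m f)
  /\
  (forall Aplus : 'cV[R]_n -> 'cV[R]_n, solution_operator A Aplus ->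
     forall (u : 'cV[R]_n) (p : 'cV[R]_m),
       block_mx A B^T B 0 *m col_mx u p = col_mx f g <->
       col_mx u p =
         block_op
           (fun x => (1%:M - C *m invmx L *m B) *m
                       Aplus ((1%:M - B^T *m invmx L *m C^T) *m x))
           (fun y => C *m invmx L *m y)
           (fun x => invmx L *m C^T *m x)
           (fun _ => 0)
           f g)
  /\
  (forall Aplus : 'M[R]_n, solution_operator A (mulmx Aplus) ->
     forall (u : 'cV[R]_n) (p : 'cV[R]_m),
       block_mx A B^T B 0 *m col_mx u p = col_mx f g <->
       col_mx u p =
         block_mx
           ((1%:M - C *m invmx L *m B) *m Aplus *m
              (1%:M - B^T *m invmx L *m C^T))
           (C *m invmx L)
           (invmx L *m C^T)
           0
         *m col_mx f g).
Proof.
have [A_sym _] := A_psd; have [M_sym _] := M_pd.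
have BE : B = C^T *m M by rewrite -[B]trmxK -MC trmx_mul M_sym.
(* [C *m x = 0] gives [B^T *m x = M *m C *m x = 0], and the rows of [B] are independent. *)
have C_inj (x : 'cV[R]_m) : C *m x = 0 -> x = 0.
  move=> Cx0; apply: trmx_inj; apply: (row_free_inj B_full).
  by apply: trmx_inj; rewrite trmx0 mul0mx trmx0 trmx_mul trmxK -MC -mulmxA Cx0 mulmx0.
have L_unit : L \in unitmx by rewrite L_def BE; apply: sym_pd_conj_unitmx.
have CB : C^T *m B^T = L by rewrite -MC mulmxA -BE L_def.
have AC : A *m C = 0 := colker_basis_mul0 C_basis.
have CA : C^T *m A = 0 by rewrite -[A]A_sym -trmx_mul AC trmx0.
have saddleE u0 : A *m u0 = (1%:M - B^T *m invmx L *m C^T) *m f ->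
    forall (u : 'cV[R]_n) (p : 'cV[R]_m),
    block_mx A B^T B 0 *m col_mx u p = col_mx f g <->
    u = (1%:M - C *m invmx L *m B) *m u0 + C *m invmx L *m g /\
    p = invmx L *m C^T *m f.
  move=> Au0 u p; rewrite mul_block_col mul0mx addr0; split.
    move=> /eq_col_mx[eqf eqg].
    have pE : p = invmx L *m C^T *m f.
      by rewrite -eqf -mulmxA mulmxDr !mulmxA CA CB mul0mx add0r mulKmx.
    split=> //.
    have Adiff0 : A *m (u - u0) = 0.
      by rewrite mulmxBr Au0 mulmxBl mul1mx -{1}eqf pE !mulmxA addrK subrr.
    have [y yE] := colker_basis_factor C_basis Adiff0.
    have uE : u = u0 + C *m y by rewrite -yE addrC subrK.
    (* With [g] in this form, [C *m invmx L *m g] splits into a term cancelling the projection of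
       [u0] and the correction [C *m y]. *)
    have -> : g = B *m u0 + L *m y by rewrite L_def -eqg uE mulmxDr mulmxA.
    rewrite mulmxDr mulmxBl mul1mx !mulmxA addrA subrK.
    by rewrite mulmxKV.
  (* Conversely, [A *m C = 0] reduces the first row to the equation for [u0], and
     [B *m C *m invmx L = 1] reduces the second to [g]. *)
  move=> [-> ->]; congr col_mx.
    rewrite mulmxDr !mulmxA mulmxBr mulmx1 !mulmxA AC !mul0mx subr0 addr0 Au0.
    by rewrite mulmxBl mul1mx subrK.
  rewrite mulmxDr !mulmxA mulmxBr mulmx1 !mulmxA -L_def mulmxV // !mul1mx.
  by rewrite subrr mul0mx add0r.
(* [Aplus] is controlled only on the range of [A], so its argument must be shown to lie there before
   its value can serve as [u0]. *)
have rhs_range : exists x : 'cV[R]_n,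
    A *m x = (1%:M - B^T *m invmx L *m C^T) *m f.
  apply: sym_range_colker A_sym C_basis _.
  by rewrite mulmxA mulmxBr mulmx1 !mulmxA CB mulmxV // mul1mx subrr mul0mx.
split; first exact: saddleE.
split=> Aplus Aplus_sol u p.
  have [saddle_sol sol_saddle] := saddleE _ (Aplus_sol _ rhs_range) u p.
  rewrite /block_op addr0; split=> [/saddle_sol[-> ->] // | /eq_col_mx[uE pE]].
  exact: sol_saddle.
have [saddle_sol sol_saddle] := saddleE _ (Aplus_sol _ rhs_range) u p.
(* Reassociating exposes [Aplus] applied to the right-hand side vector, the [u0] chosen above. *)
rewrite [X in _ <-> _ = X]mul_block_col mul0mx addr0 -(mulmxA _ _ f) -(mulmxA _ Aplus).
split=> [/saddle_sol[-> ->] // | /eq_col_mx[uE pE]].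
exact: sol_saddle.
Qed.
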